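(* Let $\mathfrak{g}$ be a finite-dimensional real or complex Lie algebra and let $\mu \in \mathfrak{g}^*$. Let $\gamma$ be a smooth curve in $\mathfrak{g}^*$ (defined for $t$ in an open interval containing $0$) such that $\gamma(0) = \mu$ and $\gamma(t) \in \mathfrak{g}^*(\mu)$ for all $t$. Then the tangent vector $\dot\gamma(0)$ vanishes on the derived algebra of the stabilizer $\mathfrak{g}_\mu$: $$\langle \dot\gamma(0), [\mathfrak{g}_\mu, \mathfrak{g}_\mu] \rangle = 0.$$
   Context: For $\mu \in \mathfrak{g}^*$, $\mathfrak{g}_\mu = \{x \in \mathfrak{g} \mid \mathrm{ad}^*x(\mu) = 0\}$ is the stabilizer of $\mu$ with respect to the coadjoint representation; equivalently, $x \in \mathfrak{g}_\mu$ if and only if $\langle \mu, [x,y]\rangle = 0$ for all $y \in \mathfrak{g}$. For an integer $k$, $\mathfrak{g}^*_k = \{\nu \in \mathfrak{g}^* \mid \dim \mathfrak{g}_\nu = k\}$ (equivalently, the union of all coadjoint orbits of codimension $k$), and $\mathfrak{g}^*(\mu) = \mathfrak{g}^*_{\dim \mathfrak{g}_\mu} = \{\nu \in \mathfrak{g}^* \mid \dim \mathfrak{g}_\nu = \dim \mathfrak{g}_\mu\}$. The pairing $\langle\cdot,\cdot\rangle$ is the natural pairing between $\mathfrak{g}^*$ and $\mathfrak{g}$, and tangent vectors to $\mathfrak{g}^*$ are identified with elements of $\mathfrak{g}^*$. *)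

(* Defs.v *)
From HB Require Import structures.
From mathcomp Require Import all_boot all_order all_algebra.
From mathcomp Require Import complex.
From mathcomp Require Import all_classical all_reals all_analysis.

Set Implicit Arguments.
Unset Strict Implicit.
Unset Printing Implicit Defensive.

Import Order.TTheory GRing.Theory Num.Theory.
Import numFieldNormedType.Exports.

Local Open Scope classical_set_scope.
Local Open Scope ring_scope.

HB.mixin Record Vector_isLieAlgebra (K : fieldType) g of Vector K g := {
  lie : g -> g -> g;
  lie_is_linearl : forall y, linear (lie^~ y);
  lie_is_linearr : forall x, linear (lie x);
  liexx : forall x, lie x x = 0;
  lie_jacobi : forall x y z,
    lie x (lie y z) + lie y (lie z x) + lie z (lie x y) = 0
}.

#[short(type="lieAlgType")]
HB.structure Definition LieAlgebra (K : fieldType) :=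
  {g of Vector K g & Vector_isLieAlgebra K g}.

Notation "[lie x , y ]" := (lie x y)
  (at level 0, x, y at level 69, format "[lie  x ,  y ]") : ring_scope.

Definition dual (K : fieldType) (g : vectType K) : Type := 'Hom(g, K^o).

HB.instance Definition _ (K : fieldType) (g : vectType K) :=
  GRing.Lmodule.copy (dual g) 'Hom(g, K^o).

Definition pairing (K : fieldType) (g : vectType K) (phi : dual g) (x : g) : K :=
  (phi : 'Hom(g, K^o)) x.

(* The topology of the finite-dimensional space g^* is given by the sup norm of
   its coordinates; all norms on it being equivalent, the choice is immaterial. *)
Section DualNorm.
Variables (K : numFieldType) (g : vectType K).

Definition dual_coord (phi : dual g) : 'rV[K]_(\dim {:g}) :=
  \row_i pairing phi (vbasis {:g})`_i.

Fact dual_coord_is_linear : linear dual_coord.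
Proof.
move=> a phi psi; apply/rowP => i; rewrite !mxE /pairing.
by rewrite add_lfunE scale_lfunE.
Qed.

HB.instance Definition _ :=
  GRing.isLinear.Build K (dual g) 'rV[K]_(\dim {:g}) _ dual_coord
    dual_coord_is_linear.

Definition dual_norm (phi : dual g) : K := `|dual_coord phi|.

Fact dual_ler_normD phi psi :
  dual_norm (phi + psi) <= dual_norm phi + dual_norm psi.
Proof. by rewrite /dual_norm raddfD ler_normD. Qed.

Fact dual_normrZ (c : K) phi : dual_norm (c *: phi) = `|c| * dual_norm phi.
Proof. by rewrite /dual_norm linearZ/= normrZ. Qed.

Fact dual_normr0_eq0 phi : dual_norm phi = 0 -> phi = 0.
Proof.
move=> /normr0_eq0 /rowP phi0; apply/lfunP => x.
rewrite zero_lfunE (coord_vbasis (memvf x)) linear_sum/= big1// => i _.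
by rewrite linearZ/=; have := phi0 i; rewrite !mxE /pairing => ->; rewrite scaler0.
Qed.

HB.instance Definition _ := Lmodule_isNormed.Build K (dual g)
  dual_ler_normD dual_normrZ dual_normr0_eq0.

End DualNorm.

(* Restriction of scalars from R[i] to R, so that the derivatives of curves
   (functions of a real variable) in a complex space make sense. *)
Definition realified (R : realType) (V : normedModType R[i]) : Type := V.

Section Realified.
Variables (R : realType) (V : normedModType R[i]).

HB.instance Definition _ := GRing.Zmodule.copy (realified V) V.

Definition realified_scale (r : R) (v : realified V) : realified V :=
  r%:C%C *: (v : V).

Fact realified_scalerA a b v :
  realified_scale a (realified_scale b v) = realified_scale (a * b) v.
Proof. by rewrite /realified_scale scalerA -rmorphM. Qed.

Fact realified_scale1r : left_id 1 realified_scale.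
Proof. by move=> v; rewrite /realified_scale rmorph1 scale1r. Qed.

Fact realified_scalerDr : right_distributive realified_scale +%R.
Proof. by move=> a u v; exact: scalerDr. Qed.

Fact realified_scalerDl v :
  {morph realified_scale^~ v : a b / a + b}.
Proof. by move=> a b; rewrite /realified_scale rmorphD scalerDl. Qed.

HB.instance Definition _ := GRing.Zmodule_isLmodule.Build R (realified V)
  realified_scalerA realified_scale1r realified_scalerDr realified_scalerDl.

Definition realified_norm (v : realified V) : R := complex.Re `|v : V|.

Lemma realified_normE v : (realified_norm v)%:C%C = `|v : V|.
Proof. by rewrite /realified_norm RRe_real// normr_real. Qed.

Fact realified_ler_normD u v :
  realified_norm (u + v) <= realified_norm u + realified_norm v.
Proof. by rewrite -lecR rmorphD/= !realified_normE ler_normD. Qed.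

Fact realified_normrZ r v :
  realified_norm (r *: v) = `|r| * realified_norm v.
Proof.
apply: (@complexI R); rewrite rmorphM/= !realified_normE.
by rewrite [LHS]normrZ normc_def/= expr0n addr0 sqrtr_sqr.
Qed.

Fact realified_normr0_eq0 v : realified_norm v = 0 -> v = 0.
Proof.
by move=> v0; apply: (@normr0_eq0 _ V); rewrite -realified_normE v0.
Qed.

HB.instance Definition _ := Lmodule_isNormed.Build R (realified V)
  realified_ler_normD realified_normrZ realified_normr0_eq0.

End Realified.

Definition smooth_on (R : realType) (V : normedModType R) (I : set R)
    (gamma : R -> V) : Prop :=
  forall (n : nat) (t : R), I t -> derivable gamma^`(n)%classic t 1.

Section Coadjoint.
Variables (K : fieldType) (g : lieAlgType K).
Implicit Types (x y : g) (mu nu : dual g) (U W : {vspace g}).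

Definition ad x : 'End(g) := linfun (lie x).

Definition coad x mu : dual g := - ((mu : 'Hom(g, K^o)) \o ad x)%VF.

Definition coad_orbit_map mu : g -> 'Hom(g, K^o) := fun x => coad x mu.

Definition stabilizer mu : {vspace g} := lker (linfun (coad_orbit_map mu)).

Definition stratum (k : nat) : set (dual g) :=
  [set nu | \dim (stabilizer nu) = k].

Definition stratum_of mu : set (dual g) := stratum (\dim (stabilizer mu)).

Definition lie_prod U W : {vspace g} :=
  <<[seq [lie x, y] | x <- vbasis U, y <- vbasis W]>>%VS.

Definition derived_algebra U : {vspace g} := lie_prod U U.

HB.instance Definition _ x := GRing.isLinear.Build K g g _ (lie x)
  (lie_is_linearr x).

Lemma adE x y : ad x y = [lie x, y]. Proof. by rewrite lfunE. Qed.

Lemma coadE x mu y : pairing (coad x mu) y = - pairing mu [lie x, y].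
Proof. by rewrite /pairing /coad opp_lfunE comp_lfunE adE. Qed.

Fact coad_orbit_map_is_linear mu : linear (coad_orbit_map mu).
Proof.
move=> a x y; apply/lfunP => z; rewrite add_lfunE scale_lfunE.
have coE u : coad_orbit_map mu u z = - (mu : 'Hom(g, K^o)) [lie u, z].
  exact: coadE.
by rewrite !coE lie_is_linearl linearP opprD scalerN.
Qed.

HB.instance Definition _ mu := GRing.isLinear.Build K g 'Hom(g, K^o) _
  (coad_orbit_map mu) (coad_orbit_map_is_linear mu).

Lemma stabilizer_coadP mu x : x \in stabilizer mu <-> coad x mu = 0.
Proof. by rewrite memv_ker lfunE; split=> /eqP. Qed.

Lemma stabilizerP mu x :
  x \in stabilizer mu <-> forall y, pairing mu [lie x, y] = 0.
Proof.
rewrite stabilizer_coadP; split=> [mux y|mux].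
  by apply: oppr_inj; rewrite -coadE mux oppr0 [LHS]zero_lfunE.
by apply/lfunP => y; rewrite [LHS]coadE mux oppr0 zero_lfunE.
Qed.

Definition lier y x := [lie x, y].

HB.instance Definition _ y := GRing.isLinear.Build K g g _ (lier y)
  (lie_is_linearl y).

Lemma mem_lie_prod U W :
  {in U & W, forall x y, [lie x, y] \in lie_prod U W}.
Proof.
move=> x y /coord_vbasis-> /coord_vbasis->.
rewrite linear_sum/=; apply: memv_suml => j _.
rewrite linearZ/=; apply: memvZ.
rewrite -/(lier _ _) linear_sum/=; apply: memv_suml => i _.
rewrite linearZ/=; apply: memvZ; apply: memv_span; apply/allpairsP.
by exists ((vbasis U)`_i, (vbasis W)`_j); rewrite !memt_nth.
Qed.

Lemma lie_prodP U W (S : {vspace g}) :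
  reflect {in U & W, forall x y, [lie x, y] \in S} (lie_prod U W <= S)%VS.
Proof.
apply: (iffP idP) => [sUWS x y Ux Wy|sUWS].
  by rewrite (subvP sUWS)// mem_lie_prod.
apply/span_subvP => _ /allpairsP[[x y] /= [Ux Wy ->]].
by rewrite sUWS ?vbasis_mem.
Qed.

End Coadjoint.

(* Main.v *)
Require Import Defs.
From mathcomp Require Import all_boot all_order all_algebra.
From mathcomp Require Import complex.
From mathcomp Require Import all_classical all_reals all_analysis.

(* In a basis, <nu, [x, y]> is a matrix of rank dim g - dim g_nu depending
   linearly on nu.  Along gamma this rank is constant, and the velocity A1 at A0
   of a curve of matrices of constant rank satisfies u A1 v = 0 whenever
   u A0 = 0 and A0 v = 0; take u, v in the stabilizer of mu. *)

Set Implicit Arguments.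
Unset Strict Implicit.
Unset Printing Implicit Defensive.

Import Order.TTheory GRing.Theory Num.Theory.
Import numFieldNormedType.Exports.
Import VectorInternalTheory.

Local Open Scope classical_set_scope.
Local Open Scope ring_scope.

Section EntrywiseLimits.
Context {K : numFieldType} {T : Type} {F : set_system T} {FF : Filter F}.

(** Convergence is entrywise because products and determinants are polynomial in the entries. *)
Definition mx_cvg m n (A : T -> 'M[K]_(m, n)) (L : 'M[K]_(m, n)) :=
  forall i j, A t i j @[t --> F] --> L i j.

Lemma mx_cvg_cst m n (A : 'M[K]_(m, n)) : mx_cvg (fun=> A) A.
Proof. by move=> i j; exact: cvg_cst. Qed.

Lemma mx_cvgM m n p (A : T -> 'M[K]_(m, n)) (B : T -> 'M[K]_(n, p)) A0 B0 :
  mx_cvg A A0 -> mx_cvg B B0 -> mx_cvg (fun t => A t *m B t) (A0 *m B0).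
Proof.
move=> AA0 BB0 i j; rewrite mxE; under eq_fun do rewrite mxE.
apply: cvg_big => [|k _]; first exact: add_continuous.
exact: cvgM (AA0 _ _) (BB0 _ _).
Qed.

Lemma mx_cvg_block m1 m2 n1 n2 (A : T -> 'M[K]_(m1, n1))
    (B : T -> 'M[K]_(m1, n2)) (C : T -> 'M[K]_(m2, n1))
    (D : T -> 'M[K]_(m2, n2)) A0 B0 C0 D0 :
  mx_cvg A A0 -> mx_cvg B B0 -> mx_cvg C C0 -> mx_cvg D D0 ->
  mx_cvg (fun t => block_mx (A t) (B t) (C t) (D t)) (block_mx A0 B0 C0 D0).
Proof.
move=> AA0 BB0 CC0 DD0 i j.
rewrite -(splitK i) -(splitK j).
case: (fintype.split i) (fintype.split j) => [i'|i'] [j'|j'] /=.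
- by rewrite block_mxEul; under eq_fun do rewrite block_mxEul; exact: AA0.
- by rewrite block_mxEur; under eq_fun do rewrite block_mxEur; exact: BB0.
- by rewrite block_mxEdl; under eq_fun do rewrite block_mxEdl; exact: CC0.
- by rewrite block_mxEdr; under eq_fun do rewrite block_mxEdr; exact: DD0.
Qed.

Lemma cvg_det n (A : T -> 'M[K]_n) A0 :
  mx_cvg A A0 -> \det (A t) @[t --> F] --> \det A0.
Proof.
move=> AA0; apply: cvg_big => [|s _]; first exact: add_continuous.
apply: cvgM; first exact: cvg_cst.
by apply: cvg_big => [|i _]; [exact: mul_continuous|exact: AA0].
Qed.

End EntrywiseLimits.

(** A nonzero determinant would force rank [m] on the product, whose rank is at most that of [A]. *)
Lemma det_mulmx_rank_lt (K : fieldType) m n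
    (P : 'M[K]_(m, n)) (A : 'M[K]_n) (Q : 'M[K]_(n, m)) :
  (\rank A < m)%N -> \det (P *m A *m Q) = 0.
Proof.
move=> rA; apply/eqP; apply: contraLR rA.
rewrite -unitfE -unitmxE -row_free_unit -leqNgt => /eqP {1}<-.
exact: leq_trans (mxrankM_maxl _ _) (mxrankM_maxr _ _).
Qed.

(* With [P *m A0 *m Q] the identity of size [\rank A0], bordering [P] and [Q] by
   [u] and [v] makes [A t] singular; dividing the last row by the parameter and
   passing to the limit gives a triangular matrix, with determinant
   [u *m A1 *m v].  The scalar [s t] is the inverse of the parameter. *)
Lemma constant_rank_tangent (K : numFieldType) (T : Type) (F : set_system T)
    (FF : ProperFilter F) n (s : T -> K) (A : T -> 'M[K]_n) (A0 A1 : 'M[K]_n)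
    (u : 'rV[K]_n) (v : 'cV[K]_n) :
  mx_cvg (F := F) A A0 ->
  mx_cvg (F := F) (fun t => s t *: (A t - A0)) A1 ->
  (\forall t \near F, \rank (A t) = \rank A0) ->
  u *m A0 = 0 -> A0 *m v = 0 -> u *m A1 *m v = 0.
Proof.
move=> AA0 AA1 rA uA0 A0v.
(* [P] and [Q] are one-sided inverses of the two factors of the rank factorization of [A0]. *)
have [P Pcol] := row_fullP (col_base_full A0).
have [Q rowQ] := row_freeP (row_base_free A0).
have PA0Q : P *m A0 *m Q = 1%:M.
  have -> : P *m A0 = P *m (col_base A0 *m row_base A0) by rewrite mulmx_base.
  by rewrite mulmxA Pcol mul1mx rowQ.
pose N t := block_mx (P *m A t *m Q) (P *m A t *m v)
  (u *m (s t *: (A t - A0)) *m Q) (u *m (s t *: (A t - A0)) *m v).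
pose N0 := block_mx (P *m A0 *m Q) (P *m A0 *m v)
  (u *m A1 *m Q) (u *m A1 *m v).
have detN : \det (N t) @[t --> F] --> \det N0.
  by apply: cvg_det; apply: mx_cvg_block;
    do 2![apply: mx_cvgM; last (try exact: mx_cvg_cst)] => //;
    exact: mx_cvg_cst.
have detN_eq0 : \forall t \near F, \det (N t) = 0.
  apply: filterS rA => t rAt.
  (* Since [u *m A0 = 0], the term in [A0] drops out and [s t] is absorbed into the last row of the
     left factor. *)
  have -> : N t = col_mx P (s t *: u) *m A t *m row_mx Q v.
    rewrite mul_col_mx mul_col_row /N -!scalemxAr -!scalemxAl mulmxBr uA0.
    by rewrite subr0.
  by apply: det_mulmx_rank_lt; rewrite rAt addn1.
have /(cvg_unique (@norm_hausdorff _ K^o) detN) :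
    \det (N t) @[t --> F] --> (0 : K).
  exact: cvg_near_cst.
rewrite /N0 -[P *m A0 *m v]mulmxA A0v mulmx0 det_lblock PA0Q det1.
rewrite mul1r det_mx11.
by move=> uv; apply/matrixP => i j; rewrite !ord1 uv mxE.
Qed.

Section CoadjointMatrix.
Variables (K : fieldType) (g : lieAlgType K).
Implicit Types (nu : dual g).

Lemma lieC (x y : g) : [lie x, y] = - [lie y, x].
Proof.
have lieDl u v w : [lie u + v, w] = [lie u, w] + [lie v, w].
  exact: (linearD (lier w)).
apply/eqP; rewrite -addr_eq0; apply/eqP.
by rewrite -(liexx (x + y)) linearD /= !lieDl !liexx add0r addr0 addrC.
Qed.

(** Gram matrix of the Kirillov form of [nu]; its left kernel is the stabilizer, in coordinates. *)
Definition coad_mx nu : 'M[K]_(dim g) :=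
  \matrix_(i, j) pairing nu [lie r2v (delta_mx 0 i), r2v (delta_mx 0 j)].

Lemma pairing_lie_coad_mx nu (u v : 'rV[K]_(dim g)) :
  pairing nu [lie r2v u, r2v v] = (u *m coad_mx nu *m v^T) 0 0.
Proof.
rewrite {1}[v]row_sum_delta linear_sum [in LHS]linear_sum /pairing.
rewrite linear_sum mxE.
apply: eq_bigr => j _; rewrite !linearZ/= mulrC !mxE; congr (_ * _).
rewrite {1}[u]row_sum_delta linear_sum -/(lier _ _) linear_sum linear_sum.
by apply: eq_bigr => i _; rewrite !linearZ/= !mxE.
Qed.

Lemma r2v_stabilizer nu (u : 'rV[K]_(dim g)) :
  (r2v u \in stabilizer nu) = (u *m coad_mx nu == 0).
Proof.
apply/idP/eqP => [/stabilizerP ustab|unu].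
  apply/rowP => j; have := ustab (r2v (delta_mx 0 j)).
  by rewrite pairing_lie_coad_mx trmx_delta -colE mxE => ->; rewrite mxE.
apply/stabilizerP => y; rewrite -[y]v2rK pairing_lie_coad_mx unu mul0mx.
by rewrite mxE.
Qed.

Lemma dim_stabilizer nu : \dim (stabilizer nu) = (dim g - \rank (coad_mx nu))%N.
Proof.
(* A subspace is stored as a matrix of coordinate rows, so its dimension is a rank and only row
   spaces need comparing. *)
rewrite -mxrank_ker; apply/eqmx_rank/rV_eqP => u.
by rewrite sub_kermx -r2v_stabilizer memvE /subsetv !genmxE r2vK//.
Qed.

Lemma rank_coad_mx nu : \rank (coad_mx nu) = (dim g - \dim (stabilizer nu))%N.
Proof. by rewrite dim_stabilizer subKn// rank_leq_row. Qed.

(** By skew-symmetry the stabilizer also gives the right kernel, which supplies the vector [v] with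
    [A0 *m v = 0]. *)
Lemma coad_mx_tr nu : (coad_mx nu)^T = - coad_mx nu.
Proof. by apply/matrixP => i j; rewrite !mxE lieC /pairing linearN. Qed.

Lemma coad_mx_scaleB c nu mu :
  coad_mx (c *: (nu - mu)) = c *: (coad_mx nu - coad_mx mu).
Proof.
apply/matrixP => i j.
by rewrite !mxE /pairing scale_lfunE add_lfunE opp_lfunE.
Qed.

End CoadjointMatrix.

Lemma cvg_pairing (K : numFieldType) (g : vectType K) (T : Type)
    {F : set_system T} {FF : Filter F} (f : T -> dual g) (phi : dual g)
    (x : g) :
  f @ F --> phi -> pairing (f t) x @[t --> F] --> pairing phi x.
Proof.
move=> fphi.
have pairingE psi : pairing psi x =
    \sum_i coord (vbasis {:g}) i x * dual_coord psi 0 i.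
  rewrite {1}(coord_vbasis (memvf x)) /pairing linear_sum.
  by apply: eq_bigr => i _; rewrite linearZ/= mxE.
(* The norm on the dual is by definition the norm of the coordinates. *)
have coordphi : dual_coord (f t) @[t --> F] --> dual_coord phi.
  apply/cvgrPdist_lt => e e0; move/cvgrPdist_lt: fphi => /(_ e e0).
  by apply: filterS => t; rewrite -raddfB.
rewrite pairingE; under eq_fun do rewrite pairingE.
apply: cvg_big => [|i _]; first exact: add_continuous.
apply: cvgM; first exact: cvg_cst.
apply: (cvg_comp _ (fun M : 'rV[K]__ => M 0 i) coordphi).
exact: coord_continuous.
Qed.

(** Both norms take the same real values, and a positive [e] in [R[i]] is itself real, so the two
    notions of smallness agree. *)
Lemma cvg_realified (R : realType) (V : normedModType R[i]) (T : Type)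
    {F : set_system T} {FF : Filter F} (f : T -> realified V)
    (v : realified V) :
  f @ F --> v -> (f : T -> V) @ F --> (v : V).
Proof.
move=> /cvgrPdist_lt fv; apply/cvgrPdist_lt => e e0.
have eE : e = (complex.Re e)%:C%C by rewrite RRe_real// gtr0_real.
have /fv : 0 < complex.Re e by rewrite -ltcR -eE.
apply: filterS => t; rewrite eE -realified_normE ltcR; exact.
Qed.

(** The filter and the scalar [s] are abstract so that one proof serves both base fields: the
    parameter stays real while [s t] lives in [K]. *)
Lemma tangent_vanishes_derived_stabilizer (K : numFieldType)
    (g : lieAlgType K) (T : Type) {F : set_system T} {FF : ProperFilter F}
    (s : T -> K) (gamma : T -> dual g) (mu delta : dual g) :
  gamma @ F --> mu ->
  s t *: (gamma t - mu) @[t --> F] --> delta ->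
  (\forall t \near F, stratum_of mu (gamma t)) ->
  forall z, z \in derived_algebra (stabilizer mu) -> pairing delta z = 0.
Proof.
move=> gmu gdelta gstr z zder.
suff /subvP/(_ _ zder) : (derived_algebra (stabilizer mu) <=
    lker (delta : 'Hom(g, K^o)))%VS by rewrite memv_ker => /eqP.
apply/lie_prodP => x y xmu ymu; rewrite memv_ker; apply/eqP.
rewrite -[x]v2rK -[y]v2rK [LHS]pairing_lie_coad_mx.
suff -> : v2r x *m coad_mx delta *m (v2r y)^T = 0 by rewrite mxE.
apply: (@constant_rank_tangent _ _ F _ _ s (fun t => coad_mx (gamma t))
  (coad_mx mu)).
- by move=> i j; rewrite mxE; under eq_fun do rewrite mxE; exact: cvg_pairing.
- move=> i j; rewrite mxE; under eq_fun do rewrite -coad_mx_scaleB mxE.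
  exact: cvg_pairing.
- by apply: filterS gstr => t; rewrite !rank_coad_mx => ->.
- by apply/eqP; rewrite -r2v_stabilizer v2rK.
- apply: trmx_inj; rewrite trmx_mul trmxK coad_mx_tr mulmxN trmx0.
  by apply/eqP; rewrite oppr_eq0 -r2v_stabilizer v2rK.
Qed.

Lemma derivable1_cvg0 (R : realType) (V : normedModType R) (f : R -> V) :
  derivable f 0 1 ->
  f t @[t --> 0^'] --> f 0 /\
  t^-1 *: (f t - f 0) @[t --> 0^'] --> f^`()%classic 0.
Proof.
move=> df; split.
  apply: cvg_within_filter; apply: differentiable_continuous.
  exact/derivable1_diffP.
move: df; rewrite derive1E /derivable /derive /=.
by under eq_fun do rewrite addr0 [_%:A]mulr1.
Qed.

Theorem proposition2p1 (R : realType) :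
  (forall (g : lieAlgType R) (mu : dual g) (I : set R) (gamma : R -> dual g),
    open I -> is_interval I -> I 0 ->
    smooth_on I gamma -> gamma 0 = mu ->
    (forall t, I t -> stratum_of mu (gamma t)) ->
    forall z : g, z \in derived_algebra (stabilizer mu) ->
      pairing (gamma^`()%classic 0) z = 0)
  /\
  (forall (g : lieAlgType R[i]) (mu : dual g) (I : set R)
      (gamma : R -> realified (dual g)),
    open I -> is_interval I -> I 0 ->
    smooth_on I gamma -> gamma 0 = mu ->
    (forall t, I t -> stratum_of mu (gamma t)) ->
    forall z : g, z \in derived_algebra (stabilizer mu) ->
      pairing (gamma^`()%classic 0) z = 0).
Proof.
split=> g mu I gamma oI _ I0 sg g0 gstr.
  (* Smoothness at order [0] is derivability of [gamma] itself. *)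
  have [gcvg dgcvg] := derivable1_cvg0 (f := gamma) (sg 0 0 I0).
  rewrite g0 in gcvg dgcvg.
  apply: (tangent_vanishes_derived_stabilizer gcvg dgcvg).
  by apply: cvg_within; apply: filterS gstr _; exact: open_nbhs_nbhs.
have [gcvg dgcvg] := derivable1_cvg0 (f := gamma) (sg 0 0 I0).
rewrite g0 in gcvg dgcvg.
(* Real scalars act on [realified] through their embedding in [R[i]], hence this [s]. *)
apply: (tangent_vanishes_derived_stabilizer (cvg_realified gcvg)
  (s := fun t => (t^-1)%:C%C) (cvg_realified dgcvg)).
by apply: cvg_within; apply: filterS gstr _; exact: open_nbhs_nbhs.
Qed.
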